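(* Let $\theta,\kappa\le\mathfrak c$ be infinite cardinals, with $\kappa$ given the discrete topology. Suppose there exists $\mathcal A\subseteq[\kappa]^\omega$ with $|\mathcal A|\le\theta$ such that for every sequence $(\mathcal C_n:n\in\omega)$ of finite, nonempty, pairwise disjoint subsets of $\kappa$ there exist an infinite $E\subseteq\omega$ and $B\in\mathcal A$ with $\left|B\cap\bigcup_{n\in E}\mathcal C_n\right|<\omega$. Then there exists $X$ with $\kappa\subseteq X\subseteq\beta\kappa$ such that $\operatorname{CL}(X)$ is pseudocompact and $X$ is not $(\theta,\omega^* )$-pseudocompact.
   Context: $\beta\kappa$ is the Stone–Čech compactification of the discrete space $\kappa$ (the space of ultrafilters on $\kappa$). $[\kappa]^\omega$ denotes the countably infinite subsets of $\kappa$. $\omega^*$ is the set of free ultrafilters on $\omega$. For $p\in\omega^*$ and a sequence $(B_n:n\in\omega)$ of subsets of $X$, $x\in X$ is a $p$-limit of $(B_n)$ if $\{n:V\cap B_n\ne\emptyset\}\in p$ for every neighborhood $V$ of $x$. $X$ is $(\theta,\omega^* )$-pseudocompact if for every family $\{(V^\alpha_n:n\in\omega):\alpha<\theta\}$ of sequences of nonempty open subsets of $X$ there is $p\in\omega^*$ such that each $(V^\alpha_n:n\in\omega)$ has a $p$-limit point in $X$. $\operatorname{CL}(X)$ is the set of nonempty closed subsets of $X$ with the Vietoris topology; pseudocompact means every continuous real-valued function is bounded. *)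

(* Defs.v *)
From Stdlib Require Import Reals List.
Open Scope R_scope.

Definition injective_fun {A B : Type} (f : A -> B) : Prop :=
  forall x y, f x = f y -> x = y.

Definition finite_set {T : Type} (S : T -> Prop) : Prop :=
  exists l : list T, forall x, S x <-> In x l.

Definition countably_infinite {T : Type} (B : T -> Prop) : Prop :=
  exists f : nat -> T, injective_fun f /\ forall x, B x <-> exists n, f n = x.

(* ultrafilters on T (points of βT) *)
Definition is_ultrafilter {T : Type} (p : (T -> Prop) -> Prop) : Prop :=
  p (fun _ => True) /\ ~ p (fun _ => False) /\
  (forall A B : T -> Prop, p A -> (forall x, A x -> B x) -> p B) /\
  (forall A B : T -> Prop, p A -> p B -> p (fun x => A x /\ B x)) /\
  (forall A : T -> Prop, p A \/ p (fun x => ~ A x)).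

(* free ultrafilters on ω, i.e. points of omega-star *)
Definition free_ultrafilter_nat (p : (nat -> Prop) -> Prop) : Prop :=
  is_ultrafilter p /\ forall A, p A -> ~ finite_set A.

(* points of βK *)
Definition uf (K : Type) := (K -> Prop) -> Prop.

(* the principal ultrafilter at x (identification K ⊆ βK) *)
Definition principal {K : Type} (x : K) : uf K := fun A => A x.

(* V is open in the subspace X of βK, whose topology has basis
   {q | A ∈ q}, A ⊆ K *)
Definition open_in {K : Type} (X : uf K -> Prop) (V : uf K -> Prop) : Prop :=
  (forall p, V p -> X p) /\
  forall p, V p -> exists A : K -> Prop, p A /\ forall q, X q -> q A -> V q.

Definition closed_in {K : Type} (X : uf K -> Prop) (F : uf K -> Prop) : Prop :=
  (forall p, F p -> X p) /\ open_in X (fun p => X p /\ ~ F p).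

Definition CL {K : Type} (X : uf K -> Prop) (F : uf K -> Prop) : Prop :=
  closed_in X F /\ exists p, F p.

Definition vietoris_subbasic {K : Type} (X : uf K -> Prop)
  (W : (uf K -> Prop) -> Prop) : Prop :=
  exists U, open_in X U /\
    ((forall F, W F <-> CL X F /\ forall p, F p -> U p) \/
     (forall F, W F <-> CL X F /\ exists p, F p /\ U p)).

Definition vietoris_open {K : Type} (X : uf K -> Prop)
  (W : (uf K -> Prop) -> Prop) : Prop :=
  (forall F, W F -> CL X F) /\
  forall F, W F -> exists l : list ((uf K -> Prop) -> Prop),
    (forall S, In S l -> vietoris_subbasic X S) /\
    (forall S, In S l -> S F) /\
    (forall G, CL X G -> (forall S, In S l -> S G) -> W G).

Definition open_R (O : R -> Prop) : Prop :=
  forall x, O x -> exists e, 0 < e /\ forall y, Rabs (y - x) < e -> O y.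

Definition CL_continuous {K : Type} (X : uf K -> Prop) (f : (uf K -> Prop) -> R) : Prop :=
  forall O, open_R O -> vietoris_open X (fun F => CL X F /\ O (f F)).

Definition CL_pseudocompact {K : Type} (X : uf K -> Prop) : Prop :=
  forall f, CL_continuous X f -> exists M, forall F, CL X F -> Rabs (f F) <= M.

Definition p_limit {K : Type} (X : uf K -> Prop) (p : (nat -> Prop) -> Prop)
  (B : nat -> uf K -> Prop) (x : uf K) : Prop :=
  X x /\ forall V, open_in X V -> V x -> p (fun n => exists y, V y /\ B n y).

(* X is (theta, omega-star)-pseudocompact, θ = cardinality of Theta *)
Definition theta_omega_pc (Theta : Type) {K : Type} (X : uf K -> Prop) : Prop :=
  forall V : Theta -> nat -> uf K -> Prop,
    (forall a n, open_in X (V a n) /\ exists y, V a n y) ->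
    exists p, free_ultrafilter_nat p /\ forall a, exists x, p_limit X p (V a) x.

(* Main.v *)
(** Call a free ultrafilter on [nat] a copy of another one if it is its image
    under some map. Diagonalizing an independent family of size continuum along
    a well-order of [Theta] gives free ultrafilters [r t] of which no two are
    copies of each other. Let [X] consist of the points of [K] and the images
    [phi(r_B)], where [B] is in [A] and [phi] is an injective sequence that meets
    [B] finitely often.

    If some [p] gave limits in [X] to the enumerations of all [B] in [A], then
    [p] would be isomorphic to [r_B] for one [B] in [A]; the limit of the
    enumeration of that [B] contains [B] and equals some [phi(r_B')], which forces
    [B' = B], although [phi(r_B)] does not contain [B].

    By the hypothesis on [A], every disjoint sequence of finite nonempty sets has a
    [p]-limit in [CL X] for some free [p]. An unbounded continuous function on [CL X] is
    unbounded on the finite subsets of [K], and any sequence of these has a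
    subsequence that splits into a growing and a disjoint part, hence it has an
    accumulation point, a contradiction. *)
From mathcomp Require Import ssreflect ssrfun ssrbool eqtype choice.
From mathcomp Require Import boolp wochoice filter.
Require Import Defs.
From Stdlib Require Import Reals List.
From Stdlib Require Import Classical ClassicalEpsilon FinFun Lra Lia.
Open Scope R_scope.

(** * Ultrafilters and their images *)

Definition image_uf {A B : Type} (h : A -> B) (p : uf A) : uf B :=
  fun S => p (fun a => S (h a)).

Lemma injective_fun_avoid {T : Type} (f : nat -> T) (l : list T) :
  injective_fun f -> exists k, ~ In (f k) l.
Proof.
move=> fI; apply: NNPP => H.
have sub : incl (List.map f (seq 0 (S (length l)))) l.
  move=> x /in_map_iff [k [<- _]]; apply: NNPP => nk; apply: H; by exists k.
have nd : NoDup (List.map f (seq 0 (S (length l)))).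
  by apply: Injective_map_NoDup (seq_NoDup _ _) => x y; apply: fI.
have := NoDup_incl_length nd sub.
rewrite length_map length_seq; lia.
Qed.

Section UltrafilterBasics.
Context {T : Type} (p : uf T) (pU : is_ultrafilter p).

Lemma uf_sub (A B : T -> Prop) : p A -> (forall x, A x -> B x) -> p B.
Proof. by case: pU => _ [_ [+ _]]; apply. Qed.

Lemma uf_and (A B : T -> Prop) : p A -> p B -> p (fun x => A x /\ B x).
Proof. by case: pU => _ [_ [_ [+ _]]]; apply. Qed.

Lemma uf_inhabited (A : T -> Prop) : p A -> exists x, A x.
Proof.
move=> pA; apply: NNPP => H; case: pU => _ [p0 _]; apply: p0.
apply: (uf_sub _ _ pA) => x Ax; apply: H; by exists x.
Qed.

Lemma uf_meet (A B : T -> Prop) : p A -> p B -> exists x, A x /\ B x.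
Proof. by move=> pA pB; apply: uf_inhabited; apply: uf_and. Qed.

Lemma uf_compl (A : T -> Prop) : ~ p A -> p (fun x => ~ A x).
Proof. by case: pU => _ [_ [_ [_ pC]]]; case: (pC A). Qed.

Lemma uf_all {I : Type} (Q : I -> T -> Prop) (l : list I) :
  (forall i, In i l -> p (Q i)) -> p (fun x => forall i, In i l -> Q i x).
Proof.
elim: l => [|i l IH] H.
  by case: pU => pT _; apply: (uf_sub _ _ pT).
have h1 := H i (or_introl erefl).
have h2 := IH (fun j jl => H j (or_intror jl)).
by apply: (uf_sub _ _ (uf_and _ _ h1 h2)) => x [a b] j [<-//|]; apply: b.
Qed.

Lemma uf_eq (q : uf T) : is_ultrafilter q -> (forall S, p S -> q S) -> p = q.
Proof.
move=> qU H; apply/predeqP => S; split; first exact: H.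
move=> qS; apply: NNPP => /uf_compl /H qn.
case: qU => _ [q0 [qs [qi _]]]; apply: q0.
by apply: (qs _ _ (qi _ _ qS qn)) => x [].
Qed.

(** If no point of [l] generates [p], then [p] contains the complement of each of them, hence a set
    disjoint from [l]. *)
Lemma uf_list_principal (l : list T) :
  p (fun x => In x l) -> exists x, In x l /\ p = principal x.
Proof.
move=> pl; apply: NNPP => H.
have : p (fun x => forall y, In y l -> x <> y).
  apply: (uf_all (fun y x => x <> y)) => y yl; apply: uf_compl => py; apply: H.
  exists y; split=> //; apply: NNPP => ne; apply: ne.
  apply/predeqP => S; rewrite /principal; split=> Sy.
    by case: (uf_meet _ _ Sy py) => x [Sx <-].
  by apply: (uf_sub _ _ py) => x ->.
by move=> /(uf_meet _ _ pl) [x [xl]] /(_ x xl).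
Qed.

Lemma image_uf_ultrafilter {U : Type} (h : T -> U) :
  is_ultrafilter (image_uf h p).
Proof.
case: (pU) => pT [p0 [pS [pI pC]]]; rewrite /image_uf.
split; first exact: pT. split; first exact: p0.
split; first by move=> A B pA AB; apply: (pS _ _ pA) => x /AB.
split; first by move=> A B pA pB; apply: pI.
by move=> A; apply: pC.
Qed.

End UltrafilterBasics.

Lemma principal_ultrafilter {T : Type} (x : T) : is_ultrafilter (principal x).
Proof.
rewrite /principal; split=> //; split=> //; split; first by move=> A B Ax; apply.
by split=> // A; apply: classic.
Qed.

Lemma uf_extension {T : Type} (F : (T -> Prop) -> Prop) :
  (forall l, (forall S, In S l -> F S) -> exists x, forall S, In S l -> S x) ->
  exists p, is_ultrafilter p /\ forall S, F S -> p S.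
Proof.
move=> fip.
pose G : uf T := fun S => exists l, (forall A, In A l -> F A) /\
  forall x, (forall A, In A l -> A x) -> S x.
have GF : ProperFilter G.
  apply: Build_ProperFilter_ex.
    by move=> S [l [lF lS]]; have [x xl] := fip l lF; exists x; apply: lS.
  split.
  - by exists nil.
  - move=> P Q [l [lF lP]] [m [mF mQ]]; exists (l ++ m)%list; split.
      by move=> A /in_app_iff [/lF|/mF].
    move=> x H; split; (apply: lP || apply: mQ) => A Al; apply: H.
      by apply/in_app_iff; left.
    by apply/in_app_iff; right.
  - by move=> P Q PQ [l [lF lP]]; exists l; split=> // x /lP /PQ.
have [p [pU Gp]] := ultraFilterLemma GF.
exists p; split; last first.
  move=> S FS; apply: Gp; exists (S :: nil); split; first by move=> A [<-|[]].
  by move=> x; apply; left.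
split; first exact: (@filterT _ p).
split; first exact: filter_not_empty.
split; first by move=> A B pA AB; exact: (filterS AB pA).
split; first by move=> A B pA pB; exact: (filterI pA pB).
by move=> A; exact: in_ultra_setVsetC.
Qed.

Lemma free_avoid (p : uf nat) : free_ultrafilter_nat p ->
  forall l : list nat, p (fun n => ~ In n l).
Proof. by move=> [pU pf] l; apply: uf_compl => // /pf; apply; exists l. Qed.

Lemma free_of_avoid (p : uf nat) : is_ultrafilter p ->
  (forall k, p (fun n => n <> k)) -> free_ultrafilter_nat p.
Proof.
move=> pU H; split=> // A pA [l lA].
have /(uf_list_principal _ pU) [k [_ pk]] : p (fun x => In x l).
  by apply: (uf_sub _ pU _ _ pA) => x; apply lA.
by have := H k; rewrite pk.
Qed.

Lemma image_free (p : uf nat) (h : nat -> nat) : free_ultrafilter_nat p ->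
  injective_fun h -> free_ultrafilter_nat (image_uf h p).
Proof.
move=> pF hI; have [pU _] := pF; apply: free_of_avoid.
  exact: image_uf_ultrafilter.
move=> k; rewrite /image_uf.
have [[j jk]|H] := classic (exists j, h j = k).
  apply: (uf_sub _ pU _ _ (free_avoid _ pF (j :: nil))) => n nj hn.
  by apply: nj; left; apply: hI; rewrite jk hn.
by case: (pU) => pT _; apply: (uf_sub _ pU _ _ pT) => n _ hn; apply: H; exists n.
Qed.

(** * Independent families and non-isomorphic free ultrafilters *)

(** Hausdorff's construction. A number codes a finite list [zs] of tests and a finite set [F] of
    admissible answers; [I y] collects the codes that admit the answers of [y]. Choosing [zs] to
    separate [l1] from [l2], and [F] as the answers of [l1], gives the required code. *)
Lemma independent_family {Y : Type} {Z : countType} (b : Y -> Z -> bool) :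
  (forall y y', y <> y' -> exists z, b y z <> b y' z) ->
  exists I : Y -> nat -> Prop, forall (l1 l2 : list Y) (l : list nat),
    (forall y, In y l1 -> ~ In y l2) ->
    exists n, ~ In n l /\ (forall y, In y l1 -> I y n) /\
      (forall y, In y l2 -> ~ I y n).
Proof.
move=> sep.
pose I y n := if (unpickle n : option (list Z * list (list bool) * nat))
  is Some (zs, F, _) then In (List.map (b y) zs) F else False.
exists I => l1 l2 l dis.
have [zs zsP] : exists zs, forall c, In c (list_prod l1 l2) ->
    exists z, In z zs /\ b (fst c) z <> b (snd c) z.
  have : forall c, In c (list_prod l1 l2) -> fst c <> snd c.
    by move=> [y y'] /in_prod_iff [/= h1 h2] e; apply: (dis y h1); rewrite e.
  elim: (list_prod l1 l2) => [|c cs IH] H; first by exists nil.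
  have [z hz] := sep _ _ (H c (or_introl erefl)).
  have [zs hzs] := IH (fun c' h => H c' (or_intror h)).
  exists (z :: zs) => c' [<-|/hzs [z' [h1 h2]]].
    by exists z; split=> //; left.
  by exists z'; split=> //; right.
(* [I] ignores the component [k]; it only supplies infinitely many codes, so that one of them avoids
   [l]. *)
pose f (k : nat) := pickle (zs, List.map (fun y => List.map (b y) zs) l1, k).
have fI : injective_fun f.
  by move=> k k' /(pcan_inj pickleK) [].
have [k kl] := injective_fun_avoid f l fI.
exists (f k); split=> //; rewrite /I /f pickleK; split.
  by move=> y yl; apply/in_map_iff; exists y.
move=> y' yl' /in_map_iff [y [e yl]].
have [/= z [zz]] := zsP (y, y') (proj2 (in_prod_iff _ _ _ _) (conj yl yl')).
by apply; apply: (ext_in_map e).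
Qed.

(** By independence, the sets [I y] for [y] in [S], the complements of the others and the
    complements of points have the finite intersection property. *)
Lemma prescribed_free_ultrafilters {Y : Type} {Z : countType}
    (b : Y -> Z -> bool) :
  (forall y y', y <> y' -> exists z, b y z <> b y' z) ->
  exists I : Y -> nat -> Prop, forall S : Y -> Prop,
    exists p, free_ultrafilter_nat p /\ forall y, p (I y) <-> S y.
Proof.
move=> /independent_family [I ind]; exists I => S.
pose F (A : nat -> Prop) := (exists y, S y /\ A = I y) \/
  (exists y, ~ S y /\ A = (fun n => ~ I y n)) \/ exists k, A = (fun n => n <> k).
have [p [pU Fp]] : exists p, is_ultrafilter p /\ forall A, F A -> p A.
  apply: uf_extension => L LF.
  have [l1 [l2 [l [h1 [h2 h]]]]] : exists l1 l2 l, (forall y, In y l1 -> S y) /\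
      (forall y, In y l2 -> ~ S y) /\ forall n, ~ In n l ->
      (forall y, In y l1 -> I y n) -> (forall y, In y l2 -> ~ I y n) ->
      forall A, In A L -> A n.
    elim: L LF => [|A L IH] LF; first by exists nil, nil, nil.
    have [l1 [l2 [l [h1 [h2 h]]]]] := IH (fun A h => LF A (or_intror h)).
    case: (LF A (or_introl erefl)) => [[y [Sy eA]]|[[y [Sy eA]]|[k eA]]].
    - exists (y :: l1), l2, l; split; first by move=> z [<-|/h1].
      split=> // n nl a1 a2 B [<-|BL]; first by rewrite eA; apply: a1; left.
      by apply: h => // z zl; apply: a1; right.
    - exists l1, (y :: l2), l; split=> //; split; first by move=> z [<-|/h2].
      move=> n nl a1 a2 B [<-|BL]; first by rewrite eA; apply: a2; left.
      by apply: h => // z zl; apply: a2; right.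
    - exists l1, l2, (k :: l); split=> //; split=> //.
      move=> n nl a1 a2 B [<-|BL]; first by rewrite eA => e; apply: nl; left.
      by apply: h => // nl'; apply: nl; right.
  have [|n [nl [a1 a2]]] := ind l1 l2 l; first by move=> y /h1 Sy /h2.
  by exists n; apply: h.
exists p; split.
  by apply: free_of_avoid => // k; apply: Fp; right; right; exists k.
move=> y; split; last by move=> Sy; apply: Fp; left; exists y.
move=> pI; apply: NNPP => nS.
have pn : p (fun n => ~ I y n) by apply: Fp; right; left; exists y.
by have [n []] := uf_meet _ pU _ _ pI pn.
Qed.

(** For [m > 0] this is the Dedekind cut of [x] tested at the rational [(a - c) / m]; the difference
    of two naturals stands for an integer numerator. *)
Definition real_cut (x : R) (z : nat * nat * nat) : bool :=
  let: (m, a, c) := z in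
  if Rlt_dec (INR a) (x * INR m + INR c) then true else false.

Lemma real_cut_separates (x y : R) : x <> y ->
  exists z, real_cut x z <> real_cut y z.
Proof.
wlog xy : x y / x < y.
  move=> H ne; case: (Rtotal_order x y) => [l|[//|l]]; first exact: H.
  by have [|z h] := H y x l; [exact: nesym|exists z; apply: nesym].
move=> _.
have [m [mh m0]] := archimed_cor1 (y - x) ltac:(lra).
have m0' : 0 < INR m by apply: lt_0_INR.
have mxy : 1 < y * INR m - x * INR m.
  have h := Rmult_lt_compat_r _ _ _ m0' mh.
  by rewrite Rinv_l in h; lra.
(* The interval from [x * m] to [y * m] is longer than 1, so the integer [k] just above [x * m] lies
   below [y * m]. *)
have [u1 u2] := archimed (x * INR m); set k := up _ in u1 u2.
have [a [c ac]] : exists a c : nat, IZR k = INR a - INR c.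
  exists (Z.to_nat k), (Z.to_nat (- k)).
  by rewrite !INR_IZR_INZ -minus_IZR; congr IZR; lia.
exists (m, a, c); rewrite /real_cut.
by case: Rlt_dec => ?; case: Rlt_dec => ? //; lra.
Qed.

(** The strict part of a reflexive well-order [W]. Totality comes from the least element of a pair,
    antisymmetry from its uniqueness. *)
Lemma wellfounded_total (T : Type) : exists lt : T -> T -> Prop,
  well_founded lt /\ forall s t, s = t \/ lt s t \/ lt t s.
Proof.
have [W wo] := well_ordering_principle {classic T}.
have minP (P : T -> Prop) : (exists x, P x) ->
    exists z, P z /\ forall y, P y -> W z y.
  move=> [x Px].
  have [|z [[/asboolP zP zm] _]] := wo (fun x => `[< P x >]).
    by exists x; apply/asboolP.
  by exists z; split=> // y Py; apply: zm; apply/asboolP.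
have tot s t : W s t \/ W t s.
  have [|z [[->|->] h]] := minP (fun x => x = s \/ x = t).
  - by exists s; left.
  - by left; apply: h; right.
  - by right; apply: h; left.
have anti s t : W s t -> W t s -> s = t.
  move=> st ts; have [|z [_ zu]] := wo (fun x => `[< x = s \/ x = t >]).
    by exists s; apply/asboolP; left.
  have rf x : W x x by case: (tot x x).
  rewrite -(zu s); last first.
    by split; [apply/asboolP; left|move=> x /asboolP [->|->]].
  by apply: zu; split; [apply/asboolP; right|move=> x /asboolP [->|->]].
exists (fun s t => W s t /\ s <> t); split; last first.
  move=> s t; have [|ne] := classic (s = t); first by left.
  by case: (tot s t) => h; right; [left|right]; split=> //; apply: nesym.
move=> x; apply: NNPP => nx.
have [|z [nz zm]] := minP (fun x => ~ Acc (fun s t => W s t /\ s <> t) x).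
  by exists x.
apply: nz; constructor=> y [yz ne]; apply: NNPP => ny.
by apply: ne; apply: anti => //; apply: zm.
Qed.

(** The independent family is indexed by pairs [(s, h)], and the set [I (s, h)] is reserved for
    making [r t] differ from the image of [r s] under [h]. This excludes only images of earlier
    ultrafilters, so the conclusion assumes maps in both directions. *)
Lemma nonisomorphic_free_ultrafilters {T : Type} (g : T -> R) :
  injective_fun g -> exists r : T -> uf nat,
    (forall t, free_ultrafilter_nat (r t)) /\
    forall s t h h', r t = image_uf h (r s) -> r s = image_uf h' (r t) -> s = t.
Proof.
move=> gI.
(* Countably many tests separate the pairs: rational cuts for the first component, single values for
   the function. *)
pose b (y : T * (nat -> nat)) (z : nat * nat * nat + nat * nat) : bool :=
  match z with
  | inl z => real_cut (g (fst y)) z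
  | inr (n, m) => Nat.eqb (snd y n) m
  end.
have [|I IP] := prescribed_free_ultrafilters b.
  move=> [t h] [t' h'] ne; have [e|ne'] := classic (t = t'); last first.
    have [|z hz] := real_cut_separates (g t) (g t'); first by move/gI.
    by exists (inl z).
  have [n hn] : exists n, h n <> h' n.
    apply: NNPP => H; apply: ne; rewrite e; congr pair.
    by apply: funext => n; apply: NNPP => hn; apply: H; exists n.
  exists (inr (n, h n)); rewrite /b /= Nat.eqb_refl => /esym /Nat.eqb_eq.
  exact: nesym.
have [u uP] := choice _ IP.
have [lt [wf tot]] := wellfounded_total T.
(* [step] puts [I (s, h)] into [r t] iff it is not in the image of [r s] under
   [h], for every [s] before [t]. *)
pose step t (rec : forall s, lt s t -> uf nat) : uf nat :=
  u (fun y => exists l : lt (fst y) t, ~ image_uf (snd y) (rec (fst y) l) (I y)).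
pose r := Fix wf (fun _ => uf nat) step.
have rE t : r t = u (fun y => lt (fst y) t /\ ~ image_uf (snd y) (r (fst y)) (I y)).
  rewrite /r Fix_eq; last first.
    move=> x f f' ff'; rewrite /step; congr u; apply: funext => y.
    by apply: propositional_extensionality; split=> -[l hl]; exists l;
      [rewrite -ff'|rewrite ff'].
  rewrite {1}/step; congr u; apply: funext => y.
  by apply: propositional_extensionality; split=> -[l hl]; [split|exists l].
have diff s t h : lt s t -> r t <> image_uf h (r s).
  move=> st e; have [_ /(_ (s, h))] :=
    uP (fun y => lt (fst y) t /\ ~ image_uf (snd y) (r (fst y)) (I y)).
  rewrite -rE /= e; tauto.
exists r; split; first by move=> t; rewrite rE; exact: (proj1 (uP _)).
move=> s t h h' e e'; case: (tot s t) => [//|[l|l]]; exfalso.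
  exact: diff l e.
exact: diff l e'.
Qed.

(** * Thinning out a sequence of finite sets *)

Lemma recursive_selection {T : Type} (P : T -> Prop) (Q : T -> T -> Prop) :
  (forall l, exists y, P y /\ forall x, In x l -> Q x y) ->
  exists e : nat -> T, (forall k, P (e k)) /\
    forall j k, (j < k)%nat -> Q (e j) (e k).
Proof.
move=> /choice [c cP].
(* [L k] is the history of the first [k] choices, latest first. *)
pose L := nat_rect (fun _ => list T) nil (fun _ l => c l :: l)%list.
exists (fun k => c (L k)); split; first by move=> k; case: (cP (L k)).
move=> j k jk; apply: (proj2 (cP (L k))).
elim: k jk => [|k IH] jk; first lia.
have [->|ne] := classic (j = k); first by left.
by right; apply: IH; lia.
Qed.

(* [R] is the limit of [F] along [q]. *)
Lemma finite_sets_subsequence {T : Type} (q : uf nat) (F : nat -> list T) :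
  free_ultrafilter_nat q -> exists (e : nat -> nat) (R : T -> Prop),
  (forall k, (k <= e k)%nat) /\
  (forall j k x, (j <= k)%nat -> R x -> In x (F (e j)) -> In x (F (e k))) /\
  (forall j k x, (j < k)%nat -> ~ R x -> In x (F (e j)) -> ~ In x (F (e k))) /\
  ((forall k x, In x (F (e k)) -> R x) \/
   (forall k, exists x, In x (F (e k)) /\ ~ R x)).
Proof.
move=> qF; have [qU _] := qF.
pose R x := q (fun n => In x (F n)).
pose full n := forall x, In x (F n) -> R x.
(* [q] decides whether [F n] lies inside [R]; restricting to [P] makes the answer the same for all
   chosen indices. *)
have [P [qP Pfull]] : exists P, q P /\
    ((forall n, P n -> full n) \/ (forall n, P n -> ~ full n)).
  have [h|h] := classic (q full); first by exists full; split=> //; left.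
  exists (fun n => ~ full n); split; last by right.
  exact: uf_compl.
(* Since [F j] is finite, [q]-many later sets agree with [R] on it. *)
pose Q j n := (j < n)%nat /\ forall x, In x (F j) -> (R x <-> In x (F n)).
have qQ j : q (Q j).
  apply: uf_and => //.
    apply: (uf_sub _ qU _ _ (free_avoid _ qF (seq 0 (S j)))) => n nj.
    by apply: NNPP => jn; apply: nj; apply/in_seq; lia.
  apply: (uf_all _ qU (fun x n => R x <-> In x (F n))) => x _.
  have [Rx|nR] := classic (R x).
    by apply: (uf_sub _ qU _ _ Rx).
  by apply: (uf_sub _ qU _ _ (uf_compl _ qU _ nR)).
have [|e [eP eQ]] := recursive_selection P Q.
  by move=> l; apply: (uf_meet _ qU _ _ qP); apply: (uf_all _ qU Q).
exists e, R; split; last split; last split.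
- elim=> [|k IH]; first lia.
  by have [h _] := eQ k (S k) ltac:(lia); lia.
- move=> j k x jk Rx xj; have [<-//|ne] := classic (j = k).
  have [_ h] := eQ j k ltac:(lia); exact: (proj1 (h x xj) Rx).
- move=> j k x jk nR xj xk; apply: nR.
  by have [_ h] := eQ j k jk; apply: (proj2 (h x xj)).
- case: Pfull => h; [left=> k|right=> k]; first exact: h.
  apply: NNPP => H; apply: (h _ (eP k)) => x xk.
  by apply: NNPP => nR; apply: H; exists x.
Qed.

(** * Finite sets and limits in the Vietoris hyperspace *)

Definition principals {K : Type} (l : list K) : uf K -> Prop :=
  fun q => exists x, In x l /\ q = principal x.

Section Hyperspace.
Context {K : Type} (X : uf K -> Prop).
Hypothesis X_uf : forall p, X p -> is_ultrafilter p.
Hypothesis X_principal : forall x, X (principal x).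

Lemma open_in_principal U q : open_in X U -> U q -> exists x, U (principal x).
Proof.
move=> [UX Uo] Uq; have [A [qA AU]] := Uo q Uq.
have [x Ax] := uf_inhabited _ (X_uf _ (UX _ Uq)) _ qA.
by exists x; apply: AU.
Qed.

Lemma open_in_and U V : open_in X U -> open_in X V ->
  open_in X (fun q => U q /\ V q).
Proof.
move=> [UX Uo] [VX Vo]; split; first by move=> p [/UX].
move=> p [Up Vp]; have [A [pA AU]] := Uo p Up; have [B [pB BV]] := Vo p Vp.
have pU := X_uf _ (UX _ Up).
exists (fun x => A x /\ B x); split; first exact: uf_and.
move=> q Xq qAB; have qU := X_uf _ Xq.
by split; [apply: AU|apply: BV] => //; apply: (uf_sub _ qU _ _ qAB) => x [].
Qed.

Lemma CL_principals (l : list K) x : In x l -> CL X (principals l).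
Proof.
move=> xl; split; last by exists (principal x), x.
split; first by move=> p [y [_ ->]].
split; first by move=> p [].
move=> p [Xp np]; exists (fun x => ~ In x l); split.
  apply: uf_compl; first exact: X_uf.
  by move=> /(uf_list_principal _ (X_uf _ Xp)).
by move=> q Xq ql; split=> // -[y [yl e]]; rewrite e in ql; apply: ql.
Qed.

(** A basic neighbourhood of [F] requires lying in an open set [U] and meeting finitely many open
    sets. As [K] is dense in [X], each of these can be met at a point of [K] inside [U]. *)
Lemma principals_dense (W : (uf K -> Prop) -> Prop) F :
  vietoris_open X W -> W F -> exists l, (exists x, In x l) /\ W (principals l).
Proof.
move=> [WCL Wo] WF; have [Ss [sub [SF SW]]] := Wo F WF.
have [[_ Fo] [p Fp]] := WCL F WF.
have FX : forall q, F q -> X q by case: (WCL F WF) => [[? _] _].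
(* Later conditions may shrink the bound [U], so the induction provides witnesses inside every
   smaller open [V] that still contains [F]. *)
have [U [Uo [FU UP]]] : exists U, open_in X U /\ (forall q, F q -> U q) /\
    forall V, open_in X V -> (forall q, V q -> U q) -> (forall q, F q -> V q) ->
    exists l, (forall x, In x l -> V (principal x)) /\
      forall G, CL X G -> (forall x, In x l -> G (principal x)) ->
        (forall q, G q -> V q) -> forall S, In S Ss -> S G.
  elim: Ss sub SF {SW} => [|S Ss IH] sub SF.
    exists X; split; last by split=> // V _ _ _; exists nil.
    split=> // q Xq; exists (fun _ => True); split=> //.
    by case: (X_uf _ Xq).
  have [|//|U [Uo [FU UP]]] := IH; first by move=> S' h; apply: sub; right.
    by move=> S' h; apply: SF; right.
  have SF0 := SF S (or_introl erefl).
  have [O [Oo [HS|HS]]] := sub S (or_introl erefl).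
    exists (fun q => U q /\ O q); split; first exact: open_in_and.
    have [_ FO] := proj1 (HS F) SF0.
    split; first by move=> q Fq; split; [apply: FU|apply: FO].
    move=> V Vo VU FV; have [|//|l [lV lP]] := UP V Vo.
      by move=> q /VU [].
    exists l; split=> // G GC lG GV S' [<-|h]; last exact: lP.
    by apply/HS; split=> // q /GV /VU [].
  exists U; split=> //; split=> // V Vo VU FV.
  have [l [lV lP]] := UP V Vo VU FV.
  have [_ [q [Fq Oq]]] := proj1 (HS F) SF0.
  have [x [Vx Ox]] := open_in_principal _ q (open_in_and _ _ Vo Oo) (conj (FV _ Fq) Oq).
  exists (x :: l)%list; split; first by move=> y [<-|/lV].
  move=> G GC lG GV S' [<-|h].
    apply/HS; split=> //; exists (principal x); split=> //.
    by apply: lG; left.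
  by apply: lP => // y yl; apply: lG; right.
have [l [lU lP]] := UP U Uo (fun q h => h) FU.
(* This extra point makes the list nonempty even if no set has to be met. *)
have [x Ux] := open_in_principal _ p Uo (FU _ Fp).
have lC : CL X (principals (x :: l)) by apply: (CL_principals _ x); left.
exists (x :: l)%list; split; first by exists x; left.
apply: SW => // S Sl; apply: lP => //.
  by move=> y yl; exists y; split=> //; right.
by move=> q [y [[<-|yl] ->]] //; apply: lU.
Qed.

(** [image_uf f p] is the [p]-limit of [f] in βK, so a single [p] must serve all selections from [C]
    at once. *)
Hypothesis X_limits : forall C : nat -> K -> Prop,
  (forall n, finite_set (C n) /\ exists x, C n x) ->
  (forall n m x, n <> m -> C n x -> C m x -> False) ->
  exists p, free_ultrafilter_nat p /\
    forall f, (forall n, C n (f n)) -> X (image_uf f p).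

(** The candidate for the [p]-limit of the finite sets [G k] in [CL X]: all [p]-limit points of the
    sequence in [X]. *)
Definition p_limit_set (p : uf nat) (G : nat -> list K) : uf K -> Prop :=
  fun q => X q /\ forall S, q S -> p (fun k => exists x, In x (G k) /\ S x).

Section PLimitSet.
Context (p : uf nat) (G : nat -> list K) (R : K -> Prop).
Hypothesis p_free : free_ultrafilter_nat p.
Hypothesis G_nonempty : forall k, exists x, In x (G k).
Hypothesis G_grow : forall j k x,
  (j <= k)%nat -> R x -> In x (G j) -> In x (G k).
Hypothesis G_split : (forall k x, In x (G k) -> R x) \/
   (forall k, exists x, In x (G k) /\ ~ R x).
Hypothesis G_limits : forall f,
  (forall k, In (f k) (G k) /\ ~ R (f k)) -> X (image_uf f p).

Let pU : is_ultrafilter p := proj1 p_free.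

Lemma p_limit_set_meets U q : open_in X U -> p_limit_set p G q -> U q ->
  p (fun k => exists x, In x (G k) /\ U (principal x)).
Proof.
move=> [UX Uo] [Xq qG] Uq; have [A [qA AU]] := Uo q Uq.
apply: (uf_sub _ pU _ _ (qG A qA)) => k [x [xk Ax]].
by exists x; split=> //; apply: AU.
Qed.

(** If [p]-many [G k] had a point outside [U], a selection of such points would avoid [R], so its
    limit would exist in [X] and belong to the limit set. Then [U] contains the limit, hence
    [p]-many of the selected points, a contradiction. *)
Lemma p_limit_set_inside U : open_in X U ->
  (forall q, p_limit_set p G q -> U q) ->
  p (fun k => forall x, In x (G k) -> U (principal x)).
Proof.
move=> [UX Uo] HU; apply: NNPP => /(uf_compl _ pU) bad.
(* A point of [R] in [G k] stays in all later sets, so it belongs to the limit set itself. *)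
have growing k x : In x (G k) -> R x -> U (principal x).
  move=> xk Rx; apply: HU; split=> // S Sx.
  apply: (uf_sub _ pU _ _ (free_avoid _ p_free (seq 0 k))) => j jk.
  exists x; split=> //; apply: (G_grow k) => //.
  by apply: NNPP => kj; apply: jk; apply/in_seq; lia.
case: G_split => [allR|someR].
  have [k] := uf_inhabited _ pU _ bad.
  by apply=> x xk; apply: growing xk (allR _ _ xk).
(* Where [G k] has no bad point, [f k] is any point of [G k] outside [R], since [G_limits]
   constrains every index. *)
have [f fP] : exists f : nat -> K, forall k, (In (f k) (G k) /\ ~ R (f k)) /\
    ((exists x, In x (G k) /\ ~ U (principal x)) -> ~ U (principal (f k))).
  apply: (choice (fun k y => (In y (G k) /\ ~ R y) /\
    ((exists x, In x (G k) /\ ~ U (principal x)) -> ~ U (principal y)))) => k.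
  have [[x [xk nU]]|H] := classic (exists x, In x (G k) /\ ~ U (principal x)).
    by exists x; split=> //; split=> // Rx; apply: nU; apply: growing xk Rx.
  by have [x xk] := someR k; exists x; split.
have Xf : X (image_uf f p) by apply: G_limits => k; case: (fP k).
have Uf : U (image_uf f p).
  apply: HU; split=> // S fS; apply: (uf_sub _ pU _ _ fS) => k Sk.
  by exists (f k); split=> //; case: (fP k) => -[].
have [A [pA AU]] := Uo _ Uf.
have [k [Ak bk]] := uf_meet _ pU _ _ pA bad.
apply: (proj2 (fP k)); last exact: AU.
by apply: NNPP => H; apply: bk => x xk; apply: NNPP => nU; apply: H; exists x.
Qed.

Lemma p_limit_set_CL : CL X (p_limit_set p G).
Proof.
split; last first.
  apply: NNPP => H.
  (* An empty limit set would lie inside the empty open set, forcing some [G k] to be empty. *)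
  have [k h] : exists k, forall x, In x (G k) -> False.
    apply: (uf_inhabited _ pU); apply: (p_limit_set_inside (fun _ => False)).
      by split.
    by move=> q h; apply: H; exists q.
  by have [x /h] := G_nonempty k.
split; first by move=> q [].
split; first by move=> q [].
move=> q [Xq nq].
have [S [qS nS]] : exists S, q S /\ ~ p (fun k => exists x, In x (G k) /\ S x).
  apply: NNPP => H; apply: nq; split=> // S qS.
  by apply: NNPP => nS; apply: H; exists S.
by exists S; split=> // q' Xq' q'S; split=> // -[_ /(_ S q'S)].
Qed.

(** Convergence along [p] in [CL X]: [p_limit_set_inside] handles the subbasic sets of containment,
    [p_limit_set_meets] those of intersection. *)
Lemma p_limit_set_vietoris W : vietoris_open X W -> W (p_limit_set p G) ->
  p (fun k => W (principals (G k))).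
Proof.
move=> [_ Wo] WH; have [Ss [sub [SH SW]]] := Wo _ WH.
have GC k : CL X (principals (G k)).
  by have [x] := G_nonempty k; apply: CL_principals.
have /(uf_all _ pU (fun S k => S (principals (G k)))) :
    forall S, In S Ss -> p (fun k => S (principals (G k))).
  move=> S Sl; have [U [Uo [HS|HS]]] := sub S Sl.
    have [_ HU] := proj1 (HS _) (SH S Sl).
    apply: (uf_sub _ pU _ _ (p_limit_set_inside U Uo HU)) => k h.
    by apply/HS; split=> // q [x [/h ? ->]].
  have [_ [q [Hq Uq]]] := proj1 (HS _) (SH S Sl).
  apply: (uf_sub _ pU _ _ (p_limit_set_meets U q Uo Hq Uq)) => k [x [xk Ux]].
  by apply/HS; split=> //; exists (principal x); split=> //; exists x.
by move=> h; apply: (uf_sub _ pU _ _ h) => k; apply: SW.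
Qed.

End PLimitSet.

Lemma CL_pseudocompact_of_limits (q0 : uf nat) : free_ultrafilter_nat q0 ->
  CL_pseudocompact X.
Proof.
move=> q0F f fc; apply: NNPP => unb.
have [F FP] : exists F : nat -> list K, forall n,
    (exists x, In x (F n)) /\ INR n < Rabs (f (principals (F n))).
  apply: (choice (fun n l => (exists x, In x l) /\ INR n < Rabs (f (principals l)))) => n.
  have [F [FC Fn]] : exists F, CL X F /\ INR n < Rabs (f F).
    apply: NNPP => H; apply: unb; exists (INR n) => F FC.
    by apply: Rnot_lt_le => lt; apply: H; exists F.
  have Oo : open_R (fun y => INR n < Rabs y).
    move=> x nx; exists (Rabs x - INR n); split; first lra.
    by move=> y; have := Rabs_triang_inv x y; rewrite (Rabs_minus_sym x y); lra.
  have [l [lne [_ lW]]] := principals_dense _ F (fc _ Oo) (conj FC Fn).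
  by exists l.
have [e [R [ek [grow [dis split]]]]] := finite_sets_subsequence _ F q0F.
pose G k := F (e k).
have Gne k : exists x, In x (G k) by case: (FP (e k)).
have [p [pF lim]] : exists p, free_ultrafilter_nat p /\ forall f,
    (forall k, In (f k) (G k) /\ ~ R (f k)) -> X (image_uf f p).
  (* If all [G k] lie in [R], there is no selection outside [R] and any free ultrafilter works. *)
  case: split => [allR|someR].
    by exists q0; split=> // h /(_ 0%nat) [/allR].
  apply: (X_limits (fun k x => In x (G k) /\ ~ R x)).
    move=> k; split; last exact: someR.
    have dec x : {R x} + {~ R x} := excluded_middle_informative (R x).
    exists (List.filter (fun x => if dec x then false else true) (G k)) => x.
    by rewrite filter_In; case: (dec x) => ?; intuition.
  move=> j k x jk [xj nR] [xk _].
  have [lt|lt] : (j < k)%nat \/ (k < j)%nat by lia.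
    exact: dis lt nR xj xk.
  exact: dis lt nR xk xj.
have HC := p_limit_set_CL p G R pF Gne grow split lim.
set v := f (p_limit_set p G).
have Oo : open_R (fun y => Rabs (y - v) < 1).
  move=> x xv; exists (1 - Rabs (x - v)); split; first lra.
  move=> y yx; have h := Rabs_triang (y - x) (x - v).
  have yv : y - x + (x - v) = y - v by ring.
  rewrite yv in h; lra.
have Wv : CL X (p_limit_set p G) /\ Rabs (f (p_limit_set p G) - v) < 1.
  by split=> //; rewrite Rminus_diag Rabs_R0; lra.
have pW := p_limit_set_vietoris p G R pF Gne grow split lim _ (fc _ Oo) Wv.
(* Near the limit, [f] is bounded by [Rabs v + 1 < N], whereas its modulus at [G k] exceeds [e k],
   which is at least [k]. *)
have [N vN] := INR_unbounded (Rabs v + 1).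
have [pU _] := pF.
have [k [[_ kv] kN]] := uf_meet _ pU _ _ pW (free_avoid _ pF (seq 0 N)).
have Nk : (N <= k)%nat.
  by apply: NNPP => h; apply: kN; apply/in_seq; lia.
have := proj2 (FP (e k)); rewrite -/(G k).
have := le_INR _ _ (Nat.le_trans _ _ _ Nk (ek k)).
have := Rabs_triang_inv (f (principals (G k))) v.
lra.
Qed.

End Hyperspace.

(** * Injective sequences and the space [X] *)

Lemma infinite_set_enumeration (E : nat -> Prop) : ~ finite_set E ->
  exists e : nat -> nat, injective_fun e /\ forall n, E (e n).
Proof.
move=> inf.
have [|e [eE ne]] := recursive_selection E (fun m n => m <> n).
  move=> l; apply: NNPP => H; apply: inf.
  exists (List.filter
    (fun n => if excluded_middle_informative (E n) then true else false) l) => n.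
  rewrite filter_In; case: excluded_middle_informative => h; split=> //; last by case.
  move=> _; split=> //; apply: NNPP => nl; apply: H; exists n; split=> // m ml mn.
  by apply: nl; rewrite -mn.
exists e; split=> // j k ejk; apply: NNPP => jk.
by have [/ne|/ne/nesym] : (j < k)%nat \/ (k < j)%nat by lia.
Qed.

Lemma injective_fun_preimage_finite {T : Type} (f : nat -> T) (S : T -> Prop) :
  injective_fun f -> finite_set S -> finite_set (fun n => S (f n)).
Proof.
move=> fI [l Sl]; apply: NNPP => /infinite_set_enumeration [e [eI eS]].
have [k] := injective_fun_avoid (fun n => f (e n)) l (fun x y h => eI _ _ (fI _ _ h)).
by apply; apply/Sl.
Qed.

Lemma injective_fun_left_inverse {T : Type} (f : nat -> T) : injective_fun f ->
  exists g : T -> nat, forall n, g (f n) = n.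
Proof.
move=> fI; have [|g gP] := choice (fun x n => forall m, f m = x -> m = n).
  move=> x; have [[n <-]|H] := classic (exists n, f n = x).
    by exists n => m /fI.
  by exists 0%nat => m e; exfalso; apply: H; exists m.
by exists g => n; rewrite -(gP (f n) n).
Qed.

Theorem theorem4p5 (Theta K : Type)
  (HTinf : exists f : nat -> Theta, injective_fun f)
  (HTc : exists g : Theta -> R, injective_fun g)
  (HKinf : exists f : nat -> K, injective_fun f)
  (HKc : exists g : K -> R, injective_fun g)
  (A : (K -> Prop) -> Prop)
  (HActbl : forall B, A B -> countably_infinite B)
  (HAcard : exists g : (K -> Prop) -> Theta,
      forall B1 B2, A B1 -> A B2 -> g B1 = g B2 -> B1 = B2)
  (HA : forall C : nat -> K -> Prop,
      (forall n, finite_set (C n) /\ exists x, C n x) ->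
      (forall n m x, n <> m -> C n x -> C m x -> False) ->
      exists (E : nat -> Prop) (B : K -> Prop),
        ~ finite_set E /\ A B /\
        finite_set (fun x => B x /\ exists n, E n /\ C n x)) :
  exists X : uf K -> Prop,
    (forall p, X p -> is_ultrafilter p) /\
    (forall x : K, X (principal x)) /\
    CL_pseudocompact X /\
    ~ theta_omega_pc Theta X.

Proof.
have [gT gTI] := HTc.
have [r [r_free r_noniso]] := nonisomorphic_free_ultrafilters gT gTI.
have [g gI] := HAcard.
(* As [g] is injective on [A], each [B] in [A] gets its own index [g B] and ultrafilter
   [r (g B)]. *)
pose X (q : uf K) := (exists x, q = principal x) \/
  exists (B : K -> Prop) (phi : nat -> K), A B /\ injective_fun phi /\
    finite_set (fun n => B (phi n)) /\ q = image_uf phi (r (g B)).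
have X_uf q : X q -> is_ultrafilter q.
  move=> [[x ->]|[B [phi [_ [_ [_ ->]]]]]]; first exact: principal_ultrafilter.
  exact: image_uf_ultrafilter _ (proj1 (r_free _)) _ _.
have X_principal x : X (principal x) by left; exists x.
exists X; split=> //; split=> //; split.
  have [t _] : exists t : Theta, True by have [f _] := HTinf; exists (f 0%nat).
  apply: (CL_pseudocompact_of_limits X X_uf X_principal _ (r t)) => // C Cfin Cdis.
  have [E [B [Einf [AB BE]]]] := HA C Cfin Cdis.
  have [e [eI eE]] := infinite_set_enumeration E Einf.
  (* The image of this ultrafilter under [f] is that of [r (g B)] under [f] after [e], which is
     injective by disjointness and meets [B] finitely often by the choice of [E]. *)
  exists (image_uf e (r (g B))); split; first exact: image_free.
  move=> f fC; have feI : injective_fun (fun n => f (e n)).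
    move=> m n h; apply: eI; apply: NNPP => ne.
    by apply: (Cdis _ _ (f (e m)) ne); [|rewrite h]; apply: fC.
  right; exists B, (fun n => f (e n)); split=> //; split=> //; split=> //.
  have [l lP] := injective_fun_preimage_finite _ _ feI BE.
  exists l => n; rewrite -lP; split; last by case.
  by move=> Bn; split=> //; exists (e n).
have [k kI] := HKinf.
(* Indices that code no member of [A] get the default sequence [k]. *)
have [enum enumP] : exists enum : Theta -> nat -> K, forall a B, A B -> g B = a ->
    injective_fun (enum a) /\ forall n, B (enum a n).
  apply: (choice (fun a f => forall B, A B -> g B = a ->
    injective_fun f /\ forall n, B (f n))) => a.
  have [[B [AB gB]]|H] := classic (exists B, A B /\ g B = a); last first.
    by exists k => B AB gB; exfalso; apply: H; exists B.
  have [f [fI fB]] := HActbl B AB.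
  exists f => B' AB' gB'; have -> : B' = B by apply: gI => //; rewrite gB'.
  by split=> // n; apply/fB; exists n.
move=> pc.
have [p [p_free p_lim]] : exists p, free_ultrafilter_nat p /\
    forall B, A B -> X (image_uf (enum (g B)) p).
  (* Points of [K] are isolated in [X], so each enumeration is a sequence of open singletons; its
     only possible [p]-limit is the image of [p]. *)
  have [|p [p_free p_lim]] := pc (fun a n q => q = principal (enum a n)).
    move=> a n; split; last by exists (principal (enum a n)).
    split; first by move=> q ->.
    move=> _ ->; exists (fun x => x = enum a n); split=> // q Xq qn.
    symmetry; apply: (uf_eq _ (principal_ultrafilter _) _ (X_uf _ Xq)).
    by move=> S Sn; apply: (uf_sub _ (X_uf _ Xq) _ _ qn) => x ->.
  exists p; split=> // B AB; have [x [Xx xlim]] := p_lim (g B).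
  have -> // : image_uf (enum (g B)) p = x.
  symmetry; apply: uf_eq; first exact: X_uf.
    exact: image_uf_ultrafilter _ (proj1 p_free) _ _.
  move=> S xS; have So : open_in X (fun q => X q /\ q S).
    by split=> [q []//|q [Xq qS]]; exists S.
  apply: (uf_sub _ (proj1 p_free) _ _ (xlim _ So (conj Xx xS))) => n.
  by move=> [y [[_ yS] yn]]; rewrite yn in yS.
(* The image of the free [p] under an injection is not principal, so it is some [phi(r_B')]; left
   inverses of both injections turn this equality into maps between [p] and [r (g B')]. *)
have iso B : A B -> exists B' phi h h', A B' /\ finite_set (fun n => B' (phi n)) /\
    image_uf (enum (g B)) p = image_uf phi (r (g B')) /\
    p = image_uf h (r (g B')) /\ r (g B') = image_uf h' p.
  move=> AB; have [eI eB] := enumP _ _ AB erefl.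
  have [inv invP] := injective_fun_left_inverse _ eI.
  case: (p_lim B AB) => [[x e]|[B' [phi [AB' [phiI [fin e]]]]]].
    have : principal x (fun y => y = x) by [].
    rewrite -e => px; case: (proj2 p_free _ px).
    apply: (injective_fun_preimage_finite _ (fun y => y = x)) => //.
    by exists (x :: nil)%list => y; split=> [->|[]//]; left.
  have [inv' invP'] := injective_fun_left_inverse _ phiI.
  exists B', phi, (fun n => inv (phi n)), (fun n => inv' (enum (g B) n)).
  split=> //; split=> //; split=> //; split; apply/predeqP => S.
    have := congr1 (fun q : uf K => q (fun x => S (inv x))) e.
    by rewrite /image_uf => <-; under eq_fun do rewrite invP.
  have := congr1 (fun q : uf K => q (fun x => S (inv' x))) e.
  by rewrite /image_uf => ->; under eq_fun do rewrite invP'.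
(* The hypothesis on [A], applied to disjoint singletons, shows that [A] is nonempty. *)
have [B0 AB0] : exists B, A B.
  have [||E [B [_ [AB _]]]] := HA (fun n x => x = k n).
  - move=> n; split; last by exists (k n).
    by exists (k n :: nil)%list => x; split=> [->|[]//]; left.
  - by move=> n m x nm -> /kI.
  - by exists B.
(* The first use of [iso] finds the [B1] whose ultrafilter is isomorphic to [p]; the second, for the
   enumeration of [B1], must return [B1] again. *)
have [B1 [_ [h [h' [AB1 [_ [_ [e e']]]]]]]] := iso B0 AB0.
have [B2 [phi [i [i' [AB2 [fin [eB [f f']]]]]]]] := iso B1 AB1.
have eB12 : B1 = B2.
  apply: gI => //; apply: (r_noniso _ _ (fun n => i' (h n)) (fun n => h' (i n))).
    by rewrite f' e.
  by rewrite e' f.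
subst B2; have [_ B1e] := enumP _ _ AB1 erefl.
have : image_uf phi (r (g B1)) B1.
  rewrite -eB; case: (proj1 p_free) => pT [_ [pS _]].
  by apply: (pS _ _ pT) => n _; apply: B1e.
exact: (fun h => proj2 (r_free (g B1)) _ h fin).
Qed.
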